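(* Let $\mathfrak X=\{x_1,\dots,x_p\}\subset\mathbb R^k$ be a grid of distinct points and $\mathcal T^{(k)}_{\mathrm{exact}}\subset SO(k)$ a finite set of rotations containing the identity, each mapping $\mathfrak X$ bijectively onto itself, with set of companion matrices $\mathcal T_{\mathrm{exact}}$. Let $S_1,\dots,S_n\in\mathbb R^p$ be deterministic, $N_1,\dots,N_n$ independent with $N_i\sim\mathcal N(0,\Sigma_i)$, $I_i=S_i+N_i$, and set $d_{ij,\mathrm{noisy}}(\mathtt O)=\|I_i-\mathtt O\circ I_j\|$, $d_{ij,\mathrm{clean}}(\mathtt O)=\|S_i-\mathtt O\circ S_j\|$, and $$\mathtt O^*_{ij,\mathrm{noisy}}\in\arg\min_{\mathtt O\in\mathcal T^{(k)}_{\mathrm{exact}}}d_{ij,\mathrm{noisy}}(\mathtt O),\qquad \mathtt O^*_{ij,\mathrm{clean}}\in\arg\min_{\mathtt O\in\mathcal T^{(k)}_{\mathrm{exact}}}d^2_{ij,\mathrm{clean}}(\mathtt O).$$ Assume Assumption G1 with $\mathcal T=\mathcal T_{\mathrm{exact}}$, and Assumptions A0 and A1. Then for any $\eta\in(0,1)$, as $n,p\to\infty$, $$\sup_{i\ne j}d(\mathtt O^*_{ij,\mathrm{noisy}},\mathtt O^*_{ij,\mathrm{clean}})=O_P\big(g(u_{n,p}^{1-\eta})\big).$$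
   Context: Images are vectors in $\mathbb R^p$ indexed by the grid points; for a rotation $\mathtt O$ preserving $\mathfrak X$, $(\mathtt O\circ v)_a=v_b$ where $x_b=\mathtt O^{-1}x_a$, i.e. $\mathtt O\circ v=P_{\mathtt O}v$ with $P_{\mathtt O}$ a permutation matrix (the companion matrix). $d$ is the canonical metric on the orthogonal group. Assumption G1 (for $\mathcal T$): for all $i$ and $O\in\mathcal T$, $\|O\Sigma_iO^T\|_{op}\le\sigma_p^2$, $\sqrt{\mathrm{trace}([O\Sigma_iO^T]^2)/p}\le s_p^2$, $\|OS_i\|\le K$ with $K$ independent of $p$, and $\sqrt{\log[|\mathcal T|n^2]}\max(\sqrt p\,s_p^2,\sigma_p)\to0$; $u_{n,p}:=\sqrt{\log[|\mathcal T|n^2]}(\sqrt p\,s_p^2+K\sigma_p)+\log[|\mathcal T|n^2]\sigma_p^2$. Assumption A0: with $\mathcal T^{(k)}_{ij,\varepsilon}:=\{\mathtt O\in\mathcal T^{(k)}_{\mathrm{exact}}: d^2_{ij,\mathrm{clean}}(\mathtt O)\le d^2_{ij,\mathrm{clean}}(\mathtt O^*_{ij,\mathrm{clean}})+\varepsilon\}$, there exists $\delta_{ij,p}>0$ such that for all $\varepsilon<\delta_{ij,p}$ and all $\mathtt O\in\mathcal T^{(k)}_{ij,\varepsilon}$, $d(\mathtt O,\mathtt O^*_{ij,\mathrm{clean}})\le g_{ij,p}(\varepsilon)$ for some positive $g_{ij,p}(\varepsilon)$. Assumption A1: $\delta_{ij,p}$ can be chosen equal to a $\delta>0$ independent of $i,j,p$,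 and there is a function $g$ with $g(\varepsilon)\to0$ as $\varepsilon\to0$ and $g_{ij,p}(x)\le g(x)$ for $x\le\delta$. $O_P$ refers to the asymptotic regime $n,p\to\infty$. *)

(* Defs.v *)
From HB Require Import structures.
From mathcomp Require Import all_boot all_order all_algebra.
From mathcomp Require Import all_classical all_reals all_analysis.
Set Implicit Arguments. Unset Strict Implicit. Unset Printing Implicit Defensive.
Import Order.TTheory GRing.Theory Num.Theory.
Import numFieldNormedType.Exports.
Local Open Scope classical_set_scope.
Local Open Scope ring_scope.

Section Defs.
Variable R : realType.

Definition enorm q (v : 'cV[R]_q) : R := Num.sqrt (\sum_i (v i 0) ^+ 2).

Definition opnorm q (M : 'M[R]_q) : R :=
  sup [set enorm (M *m v) | v in [set v : 'cV[R]_q | enorm v <= 1]].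

Definition comp_idx k p (x : 'I_p -> 'cV[R]_k) (O : 'M[R]_k) (a : 'I_p) : 'I_p :=
  odflt a [pick b | x b == invmx O *m x a].

(* Companion (permutation) matrix P_O : (P_O v)_a = v_b with x_b = O^{-1} x_a. *)
Definition compmx k p (x : 'I_p -> 'cV[R]_k) (O : 'M[R]_k) : 'M[R]_p :=
  \matrix_(a, b) (b == comp_idx x O a)%:R.

Definition is_rotation k (O : 'M[R]_k) : Prop := O *m O^T = 1%:M /\ \det O = 1.

Definition preserves_grid k p (x : 'I_p -> 'cV[R]_k) (O : 'M[R]_k) : Prop :=
  (forall a, exists b, O *m x a = x b) /\ (forall b, exists a, O *m x a = x b).

Definition card_comp k p (x : 'I_p -> 'cV[R]_k) (Tk : seq 'M[R]_k) : nat :=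
  size (undup [seq compmx x Q | Q <- Tk]).

Definition gauss_law (v : R) : set R -> \bar R :=
  if v == 0 then \d_(0 : R) else normal_prob 0 (Num.sqrt v).

Context {d : measure_display} {T : measurableType d}.

Definition gaussian_vec q (P : probability T R) (X : T -> 'cV[R]_q)
    (Sigma : 'M[R]_q) : Prop :=
  Sigma^T = Sigma /\ (forall v : 'cV[R]_q, 0 <= (v^T *m Sigma *m v) 0 0) /\
  (forall a : 'I_q, measurable_fun setT (fun w => X w a 0)) /\
  forall (v : 'cV[R]_q) (B : set R), measurable B ->
    P [set w | (v^T *m X w) 0 0 \in B] = gauss_law ((v^T *m Sigma *m v) 0 0) B.

Definition sigma_vec q (X : T -> 'cV[R]_q) : set (set T) :=
  <<s [set [set w | X w a 0 \in B] | a in [set: 'I_q] & B in [set B : set R | measurable B]] >>.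

Definition indep_vecs n q (P : probability T R) (X : 'I_n -> T -> 'cV[R]_q) : Prop :=
  forall A : 'I_n -> set T, (forall i, sigma_vec (X i) (A i)) ->
    P (\bigcap_(i in [set: 'I_n]) A i) = (\prod_(i < n) P (A i))%E.

End Defs.

(* Main.v *)
(* For an orthogonal [M], the squared noisy distance [|I_i - M I_j|^2] equals the
   squared clean distance, minus twice [<S_i, M N_j> + <M S_j, N_i> + <N_i, M N_j>],
   plus a term independent of [M]; so the noisy minimiser is a clean near-minimiser
   as soon as these three terms are uniformly small.  The first two are centred
   Gaussian with variance at most [K^2 sigma^2].  The third is Gaussian
   conditionally on [N_i], so its Laplace transform at [t] is
   [E exp (t^2 N_i^T C N_i / 2)] with [C = M Sigma_j M^T]; writing
   [t^2 C = sum_k v_k v_k^T] and absorbing one factor [exp (<v_k, N_i>^2 / 2)] at a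
   time into the Gaussian law bounds it by [exp (3/2 t^2 p s^4)] when
   [3 t^2 sigma^4 <= 1], without any spectral decomposition.  A Chernoff bound and a
   union bound over [i, j] and the companion matrices show that the clean suboptimality
   is at most [64 u] with probability at least [1 - 6/n], and [64 u <= u^(1-eta)] for
   small [u]. *)
Require Import Defs.
From HB Require Import structures.
From mathcomp Require Import all_boot all_order all_algebra.
From mathcomp Require Import all_classical all_reals all_analysis.
From mathcomp Require Import measurable_realfun.
From mathcomp Require Import ring lra.
Set Implicit Arguments. Unset Strict Implicit. Unset Printing Implicit Defensive.
Import Order.TTheory GRing.Theory Num.Theory.
Import numFieldNormedType.Exports.
Local Open Scope classical_set_scope.
Local Open Scope ring_scope.

(** * Gaussian integrals on the real line *)

(** [normal_pdf] and the Radon-Nikodym derivative of [normal_prob] have the same integral over every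
    measurable set, hence agree almost everywhere. *)
Lemma integral_normal_prob (R : realType) (m s : R) (f : R -> \bar R) :
  measurable_fun setT f -> (forall x, (0 <= f x)%E) ->
  (\int[normal_prob m s]_x f x =
   \int[lebesgue_measure]_x (f x * (normal_pdf m s x)%:E))%E.
Proof.
move=> mf f0; have dom := normal_prob_dominates m s.
rewrite -(Radon_Nikodym_SigmaFinite.change_of_variables dom f0 measurableT mf).
have mpdf : measurable_fun setT (EFin \o normal_pdf m s).
  by apply/measurable_EFinP; exact: measurable_normal_pdf.
have iRN := Radon_Nikodym_SigmaFinite.f_integrable dom.
have mRN := measurable_int _ iRN.
apply: ge0_ae_eq_integral => //.
- exact: emeasurable_funM.
- exact: emeasurable_funM.
- by move=> x _; apply: mule_ge0 => //; exact: Radon_Nikodym_SigmaFinite.f_ge0.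
- by move=> x _; rewrite mule_ge0// lee_fin normal_pdf_ge0.
apply: ae_eqe_mul2l; apply: integral_ae_eq => // E _ mE.
by rewrite -Radon_Nikodym_SigmaFinite.f_integral.
Qed.

(** Completing the square: the exponential turns the centred density into [expR (s ^+ 2 / 2)] times
    the density of mean [s ^+ 2]. *)
Lemma integral_expR_normal_prob (R : realType) (s : R) : s != 0 ->
  (\int[normal_prob 0 s]_x (expR x)%:E = (expR (s ^+ 2 / 2))%:E)%E.
Proof.
move=> s0; rewrite integral_normal_prob; last 2 first.
- exact/measurable_EFinP.
- by move=> x; rewrite lee_fin expR_ge0.
transitivity (\int[lebesgue_measure]_x
    ((expR (s ^+ 2 / 2))%:E * (normal_pdf (s ^+ 2) s x)%:E))%E; last first.
  rewrite ge0_integralZl ?integral_normal_pdf ?mule1//.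
  - by apply/measurable_EFinP; exact: measurable_normal_pdf.
  - by move=> x _; rewrite lee_fin normal_pdf_ge0.

apply: eq_integral => x _; rewrite -!EFinM; congr EFin.
rewrite !normal_pdfE// /normal_fun mulrCA [RHS]mulrCA; congr (_ * _).
by rewrite -!expRD; congr expR; field.
Qed.

(** The integrand is a multiple of the Gaussian density with mean [b / (1 - a)] and variance
    [(1 - a)^-1]. *)
Lemma integral_expR_quad (R : realType) (a b : R) : a < 1 ->
  (\int[lebesgue_measure]_z (normal_pdf 0 1 z * expR (a / 2 * z ^+ 2 + b * z))%:E
   = ((Num.sqrt (1 - a))^-1 * expR (b ^+ 2 / (2 * (1 - a))))%:E)%E.
Proof.
move=> a1; have a1' : 0 < 1 - a by rewrite subr_gt0.
set s := (Num.sqrt (1 - a))^-1.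
have s0 : 0 < s by rewrite invr_gt0 sqrtr_gt0.
have s2 : s ^+ 2 = (1 - a)^-1 by rewrite exprVn sqr_sqrtr// ltW.
pose m := b / (1 - a).
set C := s * _.
transitivity (\int[lebesgue_measure]_x (C%:E * (normal_pdf m s x)%:E))%E; last first.
  rewrite ge0_integralZl ?integral_normal_pdf ?mule1//.
  - by apply/measurable_EFinP; exact: measurable_normal_pdf.
  - by move=> x _; rewrite lee_fin normal_pdf_ge0.
  - by rewrite lee_fin mulr_ge0 ?expR_ge0// ltW.
apply: eq_integral => z _; rewrite -!EFinM; congr EFin.
have peakE : normal_peak s = s^-1 * normal_peak (1 : R).
  rewrite /normal_peak expr1n -mulrnAr mul1r sqrtrM ?sqr_ge0// sqrtr_sqr.
  by rewrite gtr0_norm// invfM.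
rewrite !normal_pdfE ?oner_neq0 ?(gt_eqF s0)// /normal_fun /C peakE.
have scale u v w y p : u * v = w * y -> p * u * v = s * w * (s^-1 * p * y) :> R.
  by move=> uv; rewrite -mulrA uv; field; rewrite gt_eqF.
apply: scale; rewrite -!expRD; congr expR.
by rewrite s2 /m; field; rewrite gt_eqF.
Qed.

(** * Inner products and positive semidefinite forms *)

Definition dot (R : realType) q (u v : 'cV[R]_q) : R := (u^T *m v) 0 0.

Definition psd (R : realType) q (S : 'M[R]_q) : Prop :=
  S^T = S /\ forall v : 'cV[R]_q, 0 <= dot v (S *m v).

Section Dot.
Context {R : realType} {q : nat}.
Implicit Types (u v w : 'cV[R]_q) (a : R) (S : 'M[R]_q).

Lemma dotE u v : dot u v = \sum_i u i 0 * v i 0.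
Proof. by rewrite /dot mxE; apply: eq_bigr => i _; rewrite !mxE. Qed.

Lemma dotC u v : dot u v = dot v u.
Proof. by rewrite !dotE; apply: eq_bigr => i _; rewrite mulrC. Qed.

Lemma dotDr u v w : dot u (v + w) = dot u v + dot u w.
Proof. by rewrite /dot mulmxDr mxE. Qed.

Lemma dotDl u v w : dot (u + v) w = dot u w + dot v w.
Proof. by rewrite dotC dotDr !(dotC w). Qed.

Lemma dotZr a u v : dot u (a *: v) = a * dot u v.
Proof. by rewrite /dot -scalemxAr mxE. Qed.

Lemma dotZl a u v : dot (a *: u) v = a * dot u v.
Proof. by rewrite dotC dotZr dotC. Qed.

Lemma dot0l u : dot 0 u = 0.
Proof. by rewrite -(scale0r 0) dotZl mul0r. Qed.

Lemma dotNr u v : dot u (- v) = - dot u v.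
Proof. by rewrite -scaleN1r dotZr mulN1r. Qed.

Lemma dotNl u v : dot (- u) v = - dot u v.
Proof. by rewrite dotC dotNr dotC. Qed.

Lemma dot_mulmxr u v (M : 'M[R]_q) : dot u (M *m v) = dot (M^T *m u) v.
Proof. by rewrite /dot trmx_mul trmxK mulmxA. Qed.

Lemma dot_symC S u v : S^T = S -> dot u (S *m v) = dot v (S *m u).
Proof. by move=> SE; rewrite dot_mulmxr SE dotC. Qed.

Lemma dotvv_ge0 u : 0 <= dot u u.
Proof. by rewrite dotE sumr_ge0// => i _; rewrite -expr2 sqr_ge0. Qed.

Lemma dotvv_eq0 u : dot u u = 0 -> u = 0.
Proof.
rewrite dotE => /eqP; rewrite psumr_eq0 => [/allP u0|i _]; last first.
  by rewrite -expr2 sqr_ge0.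
apply/colP => i; rewrite mxE; apply/eqP.
by have := u0 i (mem_index_enum i); rewrite -expr2 sqrf_eq0.
Qed.

Lemma enorm_sqr u : enorm u ^+ 2 = dot u u.
Proof.
rewrite /enorm sqr_sqrtr; last by rewrite sumr_ge0// => i _; rewrite sqr_ge0.
by rewrite dotE; apply: eq_bigr => i _; rewrite expr2.
Qed.

Lemma enorm_ge0 u : 0 <= enorm u.
Proof. exact: sqrtr_ge0. Qed.

(* The discriminant argument, applied to [z |-> |y u - z v|^2]. *)
Lemma psd_cauchy_schwarz S u v : psd S ->
  dot u (S *m v) ^+ 2 <= dot u (S *m u) * dot v (S *m v).
Proof.
move=> [SE S0].
have quad y z : 0 <= y ^+ 2 * dot u (S *m u) + 2 * y * z * dot u (S *m v)
    + z ^+ 2 * dot v (S *m v).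
  have := S0 (y *: u + z *: v).
  rewrite mulmxDr -!scalemxAr !dotDl !dotDr !dotZl !dotZr (dot_symC v u SE).
  by congr (0 <= _); ring.
have := S0 u; have := S0 v.
move: (dot u (S *m u)) (dot v (S *m v)) (dot u (S *m v)) quad => a b c quad b0 a0.
have [b_gt0|] := ltP 0 b.
  have := quad b (- c).
  have -> : b ^+ 2 * a + 2 * b * - c * c + (- c) ^+ 2 * b = b * (a * b - c ^+ 2).
    by ring.
  by rewrite pmulr_rge0// subr_ge0.
move=> b_le0; have {b_le0}b0 : b = 0 by apply/eqP; rewrite eq_le b_le0.
have [c0|c0] := eqVneq c 0; first by rewrite c0 b0 mulr0 expr0n.
(* With [b = 0] the form is affine in [z]; this [z] gives it the value [-1], a contradiction. *)
have := quad 1 (- (a + 1) / (2 * c)).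
have -> : 1 ^+ 2 * a + 2 * 1 * (- (a + 1) / (2 * c)) * c
    + (- (a + 1) / (2 * c)) ^+ 2 * b = - 1.
  by rewrite b0; field.
by rewrite oppr_ge0 ler10.
Qed.

Lemma psd1 : psd (1%:M : 'M[R]_q).
Proof. by split=> [|v]; rewrite ?trmx1// mul1mx dotvv_ge0. Qed.

Lemma cauchy_schwarz u v : dot u v ^+ 2 <= dot u u * dot v v.
Proof. by have := psd_cauchy_schwarz u v psd1; rewrite !mul1mx. Qed.

End Dot.

(** * Tilted covariances and Laplace transforms of Gaussian quadratic forms *)

Lemma measurable_dot (R : realType) d (T : measurableType d) q (Y : T -> 'cV[R]_q) c :
  (forall a, measurable_fun setT (fun w => Y w a 0)) ->
  measurable_fun setT (fun w => dot c (Y w)).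
Proof.
move=> mY; under eq_fun do rewrite dotE.
by apply: measurable_sum => i; apply: measurable_funM.
Qed.

(* The covariance [(S^-1 - v v^T)^-1] of the Gaussian law tilted by
   [exp (<v, Y>^2 / 2)], in a form that makes sense for singular [S]. *)
Definition tilt (R : realType) q (S : 'M[R]_q) (v : 'cV[R]_q) : 'M[R]_q :=
  S + (1 - dot v (S *m v))^-1 *: (S *m v *m (S *m v)^T).

Section Tilt.
Context {R : realType} {q : nat}.
Implicit Types (u v w c : 'cV[R]_q) (S : 'M[R]_q).

Lemma dot_tilt S u v w : S^T = S ->
  dot u (tilt S v *m w) = dot u (S *m w)
    + dot u (S *m v) * dot v (S *m w) / (1 - dot v (S *m v)).
Proof.
move=> SE; rewrite /tilt mulmxDl -scalemxAl dotDr dotZr; congr (_ + _).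
rewrite -(mulmxA (S *m v)) [(S *m v)^T *m w]mx11_scalar mul_mx_scalar dotZr.
by rewrite -/(dot (S *m v) w) (dot_mulmxr v w) SE; ring.
Qed.

Lemma psd_tilt S v : psd S -> dot v (S *m v) < 1 -> psd (tilt S v).
Proof.
move=> [SE S0] a1; split.
  by rewrite /tilt linearD linearZ /= trmx_mul trmxK SE.
move=> u; rewrite dot_tilt// (dot_symC u v SE) addr_ge0// divr_ge0 ?subr_ge0 ?(ltW a1)//.
by rewrite -expr2 sqr_ge0.
Qed.

End Tilt.

Section GaussianChaos.
Context {R : realType} {d : measure_display} {T : measurableType d}.
Variable mu : {sigma_finite_measure set T -> \bar R}.

(* Linearisation of the square: [exp (x^2/2) = E exp (z x)] for [z ~ N(0,1)]. *)
Lemma integral_expR_sqr q (Y : T -> 'cV[R]_q) (Q : T -> R) (S : 'M[R]_q) (K : R) v c :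
  (forall a, measurable_fun setT (fun w => Y w a 0)) ->
  measurable_fun setT Q -> psd S -> 0 <= K -> dot v (S *m v) < 1 ->
  (forall c, \int[mu]_w (expR (Q w + dot c (Y w)))%:E =
     (K * expR (dot c (S *m c) / 2))%:E)%E ->
  (\int[mu]_w (expR (Q w + dot v (Y w) ^+ 2 / 2 + dot c (Y w)))%:E =
   (K / Num.sqrt (1 - dot v (S *m v)) * expR (dot c (tilt S v *m c) / 2))%:E)%E.
Proof.
move=> mY mQ [SE S0] K0 a1 mgf.
pose f (wz : T * R) := (normal_pdf 0 1 wz.2 *
  expR (Q wz.1 + dot v (Y wz.1) * wz.2 + dot c (Y wz.1)))%:E.
have mf : measurable_fun setT f.
  apply/measurable_EFinP; apply: measurable_funM.
    by apply: measurableT_comp => //; exact: measurable_normal_pdf.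
  apply: measurableT_comp => //; apply: measurable_funD; last first.
    by apply: (measurableT_comp (measurable_dot c mY)).
  apply: measurable_funD; first exact: (measurableT_comp mQ).
  by apply: measurable_funM => //; apply: (measurableT_comp (measurable_dot v mY)).
have f0 x : (0 <= f x)%E by rewrite lee_fin mulr_ge0 ?normal_pdf_ge0 ?expR_ge0.
transitivity (\int[mu]_w \int[lebesgue_measure]_z f (w, z))%E.
  apply: eq_integral => w _.
  transitivity (\int[lebesgue_measure]_z ((expR (Q w + dot c (Y w)))%:E *
    (normal_pdf 0 1 z * expR (0 / 2 * z ^+ 2 + dot v (Y w) * z))%:E))%E; last first.
    apply: eq_integral => z _; rewrite /f -EFinM mulrCA -expRD /=.
    by congr (_ * expR _)%:E; ring.
  rewrite ge0_integralZl; last 4 first.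
  - by [].
  - apply/measurable_EFinP; apply: measurable_funM; first exact: measurable_normal_pdf.
    apply: measurableT_comp => //; apply: measurable_funD.
      by apply: measurable_funM => //; exact: measurable_funX.
    exact: measurable_funM.
  - by move=> z _; rewrite lee_fin mulr_ge0 ?normal_pdf_ge0 ?expR_ge0.
  - by rewrite lee_fin expR_ge0.
  rewrite integral_expR_quad// subr0 sqrtr1 invr1 mul1r mulr1 -EFinM -expRD.
  by congr (expR _)%:E; ring.
(* After the exchange, the inner exponent is [Q] plus a linear form for each fixed [z], so the
   hypothesis applies at [z *: v + c]; what remains is a one-dimensional Gaussian integral in
   [z]. *)
rewrite (@fubini_tonelli _ _ _ _ _ mu lebesgue_measure f mf f0).
transitivity (\int[lebesgue_measure]_z ((K * expR (dot c (S *m c) / 2))%:E *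
  (normal_pdf 0 1 z * expR (dot v (S *m v) / 2 * z ^+ 2 + dot v (S *m c) * z))%:E))%E.
  apply: eq_integral => z _; rewrite /f /=.
  under eq_integral do rewrite EFinM.
  rewrite ge0_integralZl; last 4 first.
  - by [].
  - apply/measurable_EFinP; apply: measurableT_comp => //.
    apply: measurable_funD; last exact: measurable_dot.
    by apply: measurable_funD => //; apply: measurable_funM => //; exact: measurable_dot.
  - by move=> w _; rewrite lee_fin expR_ge0.
  - by rewrite lee_fin normal_pdf_ge0.
  under eq_integral.
    move=> w _; rewrite -addrA (_ : _ + dot c (Y w) = dot (z *: v + c) (Y w)); last first.
      by rewrite dotDl dotZl mulrC.
    over.
  have scale k e1 e2 e3 p : e1 = e2 * e3 -> p * (k * e1) = k * e2 * (p * e3) :> R.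
    by move=> ->; ring.
  rewrite mgf -!EFinM; congr EFin; apply: scale; rewrite -expRD; congr expR.
  by rewrite mulmxDr -scalemxAr !dotDl !dotDr !dotZl !dotZr (dot_symC c v SE); field.
rewrite ge0_integralZl; last 4 first.
- by [].
- apply/measurable_EFinP; apply: measurable_funM; first exact: measurable_normal_pdf.
  apply: measurableT_comp => //; apply: measurable_funD.
    by apply: measurable_funM => //; exact: measurable_funX.
  exact: measurable_funM.
- by move=> z _; rewrite lee_fin mulr_ge0 ?normal_pdf_ge0 ?expR_ge0.
- by rewrite lee_fin mulr_ge0 ?expR_ge0.
rewrite integral_expR_quad// -EFinM; congr EFin.
rewrite mulrACA -expRD; congr (_ * expR _).
rewrite dot_tilt// (dot_symC c v SE); field.
by rewrite gt_eqF// subr_gt0.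
Qed.

(** Induction on [vs]: each square moves into [Q], which replaces [S] by [tilt S v] and [K] by
    [K / Num.sqrt (1 - a)]. The last hypothesis says [S A S <= S / 3] as quadratic forms, [A] being
    the sum of the [v v^T]; it survives the tilt. The factor [3 / 2] pays [3 / 4 * a] for the square
    root and [3 / 2 * (a / 2)] for the growth of the other terms. *)
Lemma integral_expR_sum_sqr q (Y : T -> 'cV[R]_q) (vs : seq 'cV[R]_q)
    (Q : T -> R) (S : 'M[R]_q) (K : R) :
  (forall a, measurable_fun setT (fun w => Y w a 0)) ->
  measurable_fun setT Q -> psd S -> 0 <= K ->
  (forall c, \int[mu]_w (expR (Q w + dot c (Y w)))%:E =
     (K * expR (dot c (S *m c) / 2))%:E)%E ->
  (forall c, \sum_(v <- vs) dot v (S *m c) ^+ 2 <= dot c (S *m c) / 3) ->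
  (\int[mu]_w (expR (Q w + (\sum_(v <- vs) dot v (Y w) ^+ 2) / 2))%:E <=
   (K * expR (3 / 2 * \sum_(v <- vs) dot v (S *m v)))%:E)%E.
Proof.
move=> mY; elim: vs Q S K => [|v vs IH] Q S K mQ psdS K0 mgf small.
  have := mgf 0; rewrite dot0l mul0r.
  under eq_integral do rewrite dot0l addr0.
  by under [X in (X <= _)%E]eq_integral do rewrite big_nil mul0r addr0;
    rewrite big_nil mulr0 => ->.
have [SE S0] := psdS.
set a := dot v (S *m v).
have a0 : 0 <= a by exact: S0.
have vs_small c : \sum_(w <- vs) dot w (S *m c) ^+ 2 <=
    dot c (S *m c) / 3 - dot v (S *m c) ^+ 2.
  by have := small c; rewrite big_cons lerBrDl.
(* Smallness at [c = v], keeping only the term of [v], reads [a ^+ 2 <= a / 3]. *)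
have a3 : a <= 1 / 3.
  have : 0 <= a / 3 - a ^+ 2.
    by apply: le_trans (vs_small v); rewrite sumr_ge0// => w _; rewrite sqr_ge0.
  by nra.
have a1 : a < 1 by lra.
have a1' : 0 < 1 - a by lra.
pose Q' w := Q w + dot v (Y w) ^+ 2 / 2.
have mQ' : measurable_fun setT Q'.
  apply: measurable_funD => //; apply: measurable_funM => //.
  by apply: measurable_funX; exact: measurable_dot.
have K'0 : 0 <= K / Num.sqrt (1 - a) by rewrite divr_ge0// sqrtr_ge0.
have mgf' c := @integral_expR_sqr q Y Q S K v c mY mQ psdS K0 a1 mgf.
have small' c : \sum_(w <- vs) dot w (tilt S v *m c) ^+ 2 <=
    dot c (tilt S v *m c) / 3.
  (* [tilt S v *m c] is [S *m (c + b *: v)], so smallness for [S] is used at the shifted vector; the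
     slack left over is [2 / 3 * b ^+ 2]. *)
  pose b := dot v (S *m c) / (1 - a).
  under eq_bigr => w _.
    rewrite (_ : dot w (tilt S v *m c) = dot w (S *m (c + b *: v))); last first.
      by rewrite dot_tilt// mulmxDr -scalemxAr dotDr dotZr /b -/a; ring.
    over.
  apply: le_trans (vs_small _) _.
  rewrite dot_tilt// mulmxDr -scalemxAr !dotDl !dotDr !dotZl !dotZr -/a.
  rewrite (dot_symC c v SE).
  have -> : dot v (S *m c) = b * (1 - a) by rewrite /b divfK// gt_eqF.
  rewrite -subr_ge0.
  set e := (X in 0 <= X); suff -> : e = 2 / 3 * b ^+ 2 by rewrite mulr_ge0// sqr_ge0.
  rewrite /e; field; lra.
have := IH _ _ _ mQ' (psd_tilt psdS a1) K'0 mgf' small'.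
under eq_integral do rewrite /Q' -addrA -mulrDl.
under [X in (_ -> X <= _)%E]eq_integral do rewrite big_cons.
move/le_trans; apply; rewrite lee_fin big_cons -/a -mulrA ler_wpM2l//.
have tr_le : \sum_(w <- vs) dot w (tilt S v *m w) <=
    \sum_(w <- vs) dot w (S *m w) + a / 2.
  under eq_bigr do rewrite dot_tilt// (dot_symC v _ SE) -/a -expr2.
  rewrite big_split /= -mulr_suml lerD2l ler_pdivrMr//.
  by apply: le_trans (vs_small v) _; rewrite -/a; nra.
(* Squared and inverted, this follows from [1 + 3 / 2 * a >= (1 - a)^-1], which holds for
   [0 <= a <= 1 / 3]. *)
have sqrt_ge : expR (- (3 / 4 * a)) <= Num.sqrt (1 - a).
  rewrite -(ger0_norm (expR_ge0 _)) -sqrtr_sqr ler_sqrt; last exact: ltW.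
  rewrite expr2 -expRD -opprD expRN -[X in _ <= X]invrK.
  rewrite lef_pV2 ?posrE ?expR_gt0 ?invr_gt0//.
  have := expR_ge1Dx (3 / 4 * a + 3 / 4 * a).
  apply: le_trans; rewrite -div1r ler_pdivrMr//; nra.
rewrite mulrC ler_pdivrMr ?sqrtr_gt0//.
apply: le_trans (ler_wpM2l (expR_ge0 _) sqrt_ge).
by rewrite -expRD ler_expR; lra.
Qed.

End GaussianChaos.

(** * Gaussian vectors and independence *)

Lemma gaussian_vec_psd (R : realType) d (T : measurableType d) q
    (P : probability T R) (X : T -> 'cV[R]_q) (S : 'M[R]_q) :
  gaussian_vec P X S -> psd S.
Proof.
by move=> [SE [S0 _]]; split=> // v; rewrite /dot mulmxA; exact: S0.
Qed.

(** [gaussian_vec] prescribes the law of every linear functional, so the integral becomes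
    one-dimensional, against a Dirac mass when the variance vanishes. *)
Lemma gaussian_vec_mgf (R : realType) d (T : measurableType d) q
    (P : probability T R) (X : T -> 'cV[R]_q) (S : 'M[R]_q) (c : 'cV[R]_q) :
  gaussian_vec P X S ->
  (\int[P]_w (expR (dot c (X w)))%:E = (expR (dot c (S *m c) / 2))%:E)%E.
Proof.
move=> [SE [S0 [mX law]]].
pose cX w : measurableTypeR R := dot c (X w).
have mc : measurable_fun setT cX by exact: (measurable_dot c mX).
pose Z : {RV P >-> measurableTypeR R} := mfun_Sub (mem_set mc : cX \in mfun).
have mexp : measurable_fun setT (fun x : measurableTypeR R => (expR x)%:E).
  exact/measurable_EFinP.
transitivity (\int[distribution P Z]_x (expR x)%:E)%E.
  by rewrite ge0_integral_distribution// => x; rewrite lee_fin expR_ge0.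
have lawZ A : measurable A -> distribution P Z A = gauss_law (dot c (S *m c)) A.
  move=> mA; rewrite /dot mulmxA -law//; congr (P _).
  by apply/seteqP; split=> w /=; rewrite inE.
have [c0|c0] := eqVneq (dot c (S *m c)) 0.
  rewrite (@eq_measure_integral _ _ _ _ \d_(0 : measurableTypeR R)); last first.
    by move=> A mA _; have := lawZ A mA; rewrite /gauss_law c0  eqxx.
  by rewrite integral_dirac// c0 mul0r diracT mul1e.
transitivity (\int[normal_prob 0 (Num.sqrt (dot c (S *m c)))]_x (expR x)%:E)%E.
  apply: eq_measure_integral => A mA _; have := lawZ A mA.
  by rewrite /gauss_law (negbTE c0).
have c_ge0 : 0 <= dot c (S *m c) by rewrite /dot mulmxA; exact: S0.
by rewrite integral_expR_normal_prob ?sqr_sqrtr// sqrtr_eq0 -ltNge lt_def c0.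
Qed.

Section IndependentSigmaAlgebras.
Context {R : realType} {d : measure_display} {T : measurableType d}.
Variables (P : probability T R) (G1 G2 : set (set T)).
Notation T1 := (g_sigma_algebraType G1).
Notation T2 := (g_sigma_algebraType G2).

(* Independence says that the image of [P] under the diagonal embedding
   [w |-> (w, w)] is the product of the restrictions of [P]. *)
Lemma integral_indep (f : T1 * T2 -> \bar R) :
  <<s G1 >> `<=` @measurable d T -> <<s G2 >> `<=` @measurable d T ->
  (forall A B, <<s G1 >> A -> <<s G2 >> B -> P (A `&` B) = (P A * P B)%E) ->
  measurable_fun setT f -> (forall z, (0 <= f z)%E) ->
  (\int[P]_w f (w, w) = \int[P]_x \int[P]_y f (x, y))%E.
Proof.
move=> sG1 sG2 indep mf f0.
have m1 : measurable_fun setT (id : T -> T1).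
  by move=> _ B mB; rewrite setTI; exact: sG1.
have m2 : measurable_fun setT (id : T -> T2).
  by move=> _ B mB; rewrite setTI; exact: sG2.
have m12 : measurable_fun setT (fun w : T => (w, w) : T1 * T2).
  exact: measurable_fun_pair.
pose X1 : {RV P >-> T1} := mfun_Sub (mem_set m1 : (id : T -> T1) \in mfun).
pose X2 : {RV P >-> T2} := mfun_Sub (mem_set m2 : (id : T -> T2) \in mfun).
pose X12 : {RV P >-> (T1 * T2)%type} :=
  mfun_Sub (mem_set m12 : (fun w : T => (w, w) : T1 * T2) \in mfun).
transitivity (\int[distribution P X12]_z f z)%E.
  by rewrite ge0_integral_distribution.
(* By [indep] the two measures agree on rectangles, which determines the product measure. *)
rewrite -(@eq_measure_integral _ _ _ _ (distribution P X12)
  (distribution P X1 \x distribution P X2)%E); last first.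
  by move=> A mA _; exact: product_measure_unique.
rewrite fubini_tonelli1//.
rewrite ge0_integral_distribution//; last 2 first.
- exact: measurable_fun_fubini_tonelli_F.
- by move=> x; apply: integral_ge0.
apply: eq_integral => x _ /=; rewrite /fubini_F ge0_integral_distribution//.
exact: measurableT_comp.
Qed.

End IndependentSigmaAlgebras.

Lemma sub_sigma_vec (R : realType) d (T : measurableType d) q (X : T -> 'cV[R]_q) :
  (forall a, measurable_fun setT (fun w => X w a 0)) ->
  sigma_vec X `<=` @measurable d T.
Proof.
move=> mX; apply: smallest_sub; first exact: sigma_algebra_measurable.
move=> _ [a _ [B mB <-]]; rewrite -[X in measurable X]setTI.
under eq_set do rewrite in_setE.
exact: mX.
Qed.

(** * Semidefinite matrices: rank-one sums, traces, operator norm *)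

Section PsdMatrices.
Context {R : realType} {q : nat}.
Implicit Types (u v w : 'cV[R]_q) (S A B : 'M[R]_q).

Lemma dot_delta A i j : dot (delta_mx i 0) (A *m delta_mx j 0) = A i j.
Proof.
rewrite -colE dotE (bigD1 i)//= big1 => [|k /negbTE ki].
  by rewrite !mxE !eqxx mul1r addr0.
by rewrite !mxE ki mul0r.
Qed.

Lemma psd_diag_ge0 A i : psd A -> 0 <= A i i.
Proof. by move=> [_ A0]; rewrite -(dot_delta A); exact: A0. Qed.

Lemma psd_diag_eq0 A i j : psd A -> A i i = 0 -> A i j = 0.
Proof.
move=> psdA Aii; apply/eqP; rewrite -sqrf_eq0 eq_le sqr_ge0 andbT.
have := psd_cauchy_schwarz (delta_mx i 0) (delta_mx j 0) psdA.
by rewrite !dot_delta Aii mul0r.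
Qed.

(** Cholesky elimination: subtracting [v v^T], with [v] the normalised [i]-th column, leaves a
    matrix that is semidefinite by Cauchy-Schwarz. It clears the [i]-th diagonal entry and keeps the
    zero ones, so the count of nonzero diagonal entries drops; once it is zero, the matrix
    vanishes. *)
Lemma psd_sum_rank1 A : psd A -> exists vs : seq 'cV[R]_q, A = \sum_(v <- vs) v *m v^T.
Proof.
have [m] := ubnP #|[pred i | A i i != 0]|.
elim: m A => // m IH A ltm psdA; have [AE A0] := psdA.
have [i Aii|diag0] := pickP (fun i => A i i != 0); last first.
  exists [::]; rewrite big_nil; apply/matrixP => i j; rewrite mxE.
  by apply: psd_diag_eq0 => //; apply/eqP/negbFE/diag0.
have Aii_gt0 : 0 < A i i by rewrite lt_def Aii psd_diag_ge0.
pose v : 'cV[R]_q := (Num.sqrt (A i i))^-1 *: (A *m delta_mx i 0).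
pose A' := A - v *m v^T.
have dotA' u w : dot u (A' *m w) =
    dot u (A *m w) - dot u (A *m delta_mx i 0) * dot w (A *m delta_mx i 0) / A i i.
  rewrite mulmxBl dotDr dotNr -mulmxA [v^T *m w]mx11_scalar mul_mx_scalar dotZr.
  rewrite -/(dot v w) (dotC v w) /v !dotZr -[X in _ / X](@sqr_sqrtr _ (A i i)) ?(ltW Aii_gt0)//.
  by congr (_ - _); field; rewrite gt_eqF// sqrtr_gt0.
have psdA' : psd A'.
  split; first by rewrite /A' linearB /= trmx_mul trmxK AE.
  move=> u; rewrite dotA' subr_ge0 ler_pdivrMr// -expr2.
  by rewrite -(dot_delta A i i); exact: psd_cauchy_schwarz.
have [|vs vsE] := IH A' _ psdA'; last first.
  by exists (v :: vs); rewrite big_cons -vsE /A' addrC subrK.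
rewrite -ltnS; apply: leq_trans ltm; rewrite ltnS; apply: proper_card.
have A'E j : A' j j = A j j - A j i ^+ 2 / A i i.
  by rewrite -(dot_delta A') dotA' !dot_delta expr2.
apply/properP; split.
  apply/fintype.subsetP => j; rewrite !inE; apply: contraNneq => Ajj.
  by rewrite A'E Ajj (psd_diag_eq0 _ psdA Ajj) expr0n mul0r subrr.
by exists i; rewrite !inE// A'E expr2 mulfK// subrr eqxx.
Qed.

Lemma dot_sum_rank1 (vs : seq 'cV[R]_q) u w :
  dot u ((\sum_(v <- vs) v *m v^T) *m w) = \sum_(v <- vs) dot v u * dot v w.
Proof.
elim: vs => [|v vs IH]; first by rewrite !big_nil mul0mx dotC dot0l.
rewrite !big_cons mulmxDl dotDr IH; congr (_ + _).
rewrite -mulmxA [v^T *m w]mx11_scalar mul_mx_scalar dotZr -/(dot v w).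
by rewrite mulrC (dotC u).
Qed.

Lemma mxtrace_sum_rank1 (vs : seq 'cV[R]_q) S :
  \tr ((\sum_(v <- vs) v *m v^T) *m S) = \sum_(v <- vs) dot v (S *m v).
Proof.
rewrite mulmx_suml linear_sum /=; apply: eq_bigr => v _.
by rewrite -mulmxA mxtrace_mulC -mulmxA trace_mx11 /dot mulmxA.
Qed.

Lemma mxtrace_sqr_ge0 A : A^T = A -> 0 <= \tr (A *m A).
Proof.
move=> AE; rewrite -{1}AE; apply: sumr_ge0 => i _; rewrite mxE.
by apply: sumr_ge0 => j _; rewrite mxE -expr2 sqr_ge0.
Qed.

(** Expand the nonnegative trace of [(A - B) *m (A - B)]. *)
Lemma mxtrace_mul_le A B (t : R) : A^T = A -> B^T = B ->
  \tr (A *m A) <= t -> \tr (B *m B) <= t -> \tr (A *m B) <= t.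
Proof.
move=> AE BE At Bt.
have : 0 <= \tr ((A - B) *m (A - B)) by rewrite mxtrace_sqr_ge0// linearB /= AE BE.
rewrite mulmxBl !mulmxBr !linearB /= (mxtrace_mulC B A).
lra.
Qed.

(** Cauchy-Schwarz for the form [S] at [S *m v] and [v] gives [a ^+ 2 <= l * a * c], where [a] is
    the left side and [c] is [dot v (S *m v)]; then [a] is cancelled. *)
Lemma psd_sqr_le S (l : R) v : psd S -> 0 <= l ->
  (forall u, dot u (S *m u) <= l * dot u u) ->
  dot (S *m v) (S *m v) <= l * dot v (S *m v).
Proof.
move=> psdS l0 Sl; have := psd_cauchy_schwarz (S *m v) v psdS.
have := Sl (S *m v); have := psdS.2 v; have := dotvv_ge0 (S *m v).
move: (dot (S *m v) (S *m v)) => a.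
move: (dot (S *m v) (S *m (S *m v))) (dot v (S *m v)) => b c a0 c0 bla abc.
have [->|a_neq0] := eqVneq a 0; first by rewrite mulr_ge0.
have a_gt0 : 0 < a by rewrite lt_def a_neq0.
have : a * a <= a * (l * c).
  rewrite -expr2; apply: le_trans abc _; rewrite mulrA (mulrC a); exact: ler_wpM2r.
by rewrite ler_pM2l.
Qed.

(** The Frobenius norm serves as [b]. Boundedness is what makes the [sup] in [opnorm] an upper
    bound. *)
Lemma enorm_mulmx_bound S : exists b : R, forall v, enorm (S *m v) <= b * enorm v.
Proof.
exists (Num.sqrt (\sum_i dot (row i S)^T (row i S)^T)) => v.
rewrite -[leLHS]ger0_norm ?enorm_ge0// -sqrtr_sqr enorm_sqr.
rewrite /enorm -sqrtrM ?sumr_ge0// => [|i _]; last exact: dotvv_ge0.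
apply: ler_wsqrtr; rewrite dotE mulr_suml; apply: ler_sum => i _.
have -> : (S *m v) i 0 = dot (row i S)^T v.
  by rewrite /dot trmxK -row_mul [RHS]mxE.
rewrite -expr2; apply: le_trans (cauchy_schwarz _ _) _.
by rewrite ler_wpM2l ?dotvv_ge0// dotE; apply: ler_sum => j _; rewrite expr2.
Qed.

Lemma opnorm_quad S (l : R) v : opnorm S <= l -> dot v (S *m v) <= l * dot v v.
Proof.
move=> Sl; have [->|v0] := eqVneq v 0; first by rewrite !dot0l mulr0.
have r0 : 0 < enorm v.
  rewrite lt_def enorm_ge0 andbT; apply: contra_neq v0 => v0.
  by apply: dotvv_eq0; rewrite -enorm_sqr v0 expr0n.
pose u := (enorm v)^-1 *: v.
have uu : dot u u = 1.
  by rewrite /u dotZl dotZr -enorm_sqr; field; rewrite gt_eqF.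
have u1 : enorm u = 1 by rewrite -[LHS]ger0_norm ?enorm_ge0// -sqrtr_sqr enorm_sqr uu sqrtr1.
have Su : enorm (S *m u) <= l.
  apply: le_trans Sl; apply: ub_le_sup; last by exists u => //=; rewrite u1.
  have [b bS] := enorm_mulmx_bound S; exists `|b| => _ [w /= w1 <-].
  apply: le_trans (bS w) _; apply: le_trans (ler_wpM2r (enorm_ge0 _) (ler_norm b)) _.
  by rewrite ler_piMr.
have uSu : dot u (S *m u) <= l.
  apply: le_trans Su; apply: le_trans (ler_norm _) _.
  rewrite -sqrtr_sqr -[leRHS]ger0_norm ?enorm_ge0// -sqrtr_sqr; apply: ler_wsqrtr.
  by rewrite enorm_sqr -[leRHS]mul1r -uu; exact: cauchy_schwarz.
have vE : v = enorm v *: u by rewrite /u scalerA divff ?scale1r// gt_eqF.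
suff quad r : dot (r *: u) (S *m (r *: u)) <= l * dot (r *: u) (r *: u).
  by have := quad (enorm v); rewrite -vE.
clearbody u; rewrite -scalemxAr !dotZl !dotZr uu.
have -> : l * (r * (r * 1)) = r * (r * l) by ring.
by rewrite !mulrA -expr2 ler_wpM2l ?sqr_ge0.
Qed.

End PsdMatrices.

(* Conditionally on [X], the bilinear form is Gaussian with variance
   [X^T C X], so its Laplace transform is that of a Gaussian quadratic form. *)
Lemma gaussian_bilinear_mgf (R : realType) d (T : measurableType d) q
    (P : probability T R) (X Y : T -> 'cV[R]_q) (SX SY M : 'M[R]_q) (l r t : R) :
  let C := M *m SY *m M^T in
  gaussian_vec P X SX -> gaussian_vec P Y SY ->
  (forall A B, sigma_vec X A -> sigma_vec Y B -> P (A `&` B) = (P A * P B)%E) ->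
  0 <= l -> (forall v, dot v (SX *m v) <= l * dot v v) ->
  (forall v, dot v (C *m v) <= l * dot v v) ->
  \tr (SX *m SX) <= r -> \tr (C *m C) <= r -> 3 * t ^+ 2 * l ^+ 2 <= 1 ->
  (\int[P]_w (expR (t * dot (X w) (M *m Y w)))%:E <=
   (expR (3 / 2 * (t ^+ 2 * r)))%:E)%E.
Proof.
move=> C gX gY indep l0 SXl Cl SXr Cr tl.
have [_ [_ [mX _]]] := gX; have [_ [_ [mY _]]] := gY.
have psdX := gaussian_vec_psd gX; have psdY := gaussian_vec_psd gY.
have dotC u v : dot u (C *m v) = dot (M^T *m u) (SY *m (M^T *m v)).
  by rewrite -dot_mulmxr !mulmxA.
have psdC : psd C.
  split; first by rewrite /C !trmx_mul trmxK psdY.1 mulmxA.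
  by move=> v; rewrite dotC; exact: psdY.2.
have psdA : psd (t ^+ 2 *: C).
  split; first by rewrite linearZ /= psdC.1.
  by move=> v; rewrite -scalemxAl dotZr mulr_ge0 ?sqr_ge0//; exact: psdC.2.
have [vs vsE] := psd_sum_rank1 psdA.
have sum_sqr u : \sum_(v <- vs) dot v u ^+ 2 = t ^+ 2 * dot u (C *m u).
  rewrite -dotZr scalemxAl vsE dot_sum_rank1.
  by apply: eq_bigr => v _; rewrite expr2.
(* The generators are spelled out so that the integrand can be typed on the product of two
   sigma-algebras carried by the same space [T]. *)
pose G1 := [set [set w | X w a 0 \in B] | a in [set: 'I_q] & B in [set B : set R | measurable B]].
pose G2 := [set [set w | Y w a 0 \in B] | a in [set: 'I_q] & B in [set B : set R | measurable B]].
have mX1 a : measurable_fun setT (fun w : g_sigma_algebraType G1 => X w a 0).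
  move=> _ B mB; rewrite setTI; apply: sub_sigma_algebra.
  by exists a => //; exists B => //; under eq_set do rewrite in_setE.
have mY2 a : measurable_fun setT (fun w : g_sigma_algebraType G2 => Y w a 0).
  move=> _ B mB; rewrite setTI; apply: sub_sigma_algebra.
  by exists a => //; exists B => //; under eq_set do rewrite in_setE.
pose f (z : g_sigma_algebraType G1 * g_sigma_algebraType G2) :=
  (expR (t * dot (X z.1) (M *m Y z.2)))%:E.
have mf : measurable_fun setT f.
  apply/measurable_EFinP; apply: measurableT_comp => //; apply: measurable_funM => //.
  under eq_fun do rewrite dotE; apply: measurable_sum => a.
  apply: measurable_funM; first exact: (measurableT_comp (mX1 a)).
  under eq_fun do rewrite mxE; apply: measurable_sum => b.
  by apply: measurable_funM => //; exact: (measurableT_comp (mY2 b)).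
rewrite (@integral_indep _ _ _ P G1 G2 f
  (sub_sigma_vec mX) (sub_sigma_vec mY) indep mf); last first.
  by move=> z; rewrite lee_fin expR_ge0.
rewrite /f /=.
under eq_integral.
  move=> w _; rewrite (_ : \int[P]_y _ =
    (expR (0 + (\sum_(v <- vs) dot v (X w) ^+ 2) / 2))%:E)%E; last first.
    transitivity (\int[P]_y (expR (dot (t *: (M^T *m X w)) (Y y)))%:E)%E.
      by apply: eq_integral => y _; rewrite dotZl -dot_mulmxr.
    rewrite (gaussian_vec_mgf _ gY) sum_sqr dotC add0r -scalemxAr dotZl dotZr.
    by rewrite mulrA -expr2.
  over.
apply: le_trans (integral_expR_sum_sqr (K := 1) mX _ psdX ler01 _ _) _ => //.
- move=> c; rewrite mul1r -(gaussian_vec_mgf _ gX).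
  by apply: eq_integral => w _; rewrite add0r.
(* Smallness: bound [C] by [l], then the square of [SX] by [l] times [SX], and use
   [3 * t ^+ 2 * l ^+ 2 <= 1]. *)
- move=> c; rewrite sum_sqr ler_pdivlMr//.
  have c0 := psdX.2 c.
  apply: (@le_trans _ _ (t ^+ 2 * (l * (l * dot c (SX *m c))) * 3)).
    rewrite ler_wpM2r// ler_wpM2l ?sqr_ge0//.
    by apply: le_trans (Cl _) _; rewrite ler_wpM2l// psd_sqr_le.
  rewrite (_ : _ * 3 = (3 * t ^+ 2 * l ^+ 2) * dot c (SX *m c)); last by ring.
  by rewrite ler_piMl.
rewrite mul1r lee_fin ler_expR ler_wpM2l// -mxtrace_sum_rank1 -vsE -scalemxAl.
rewrite linearZ /= ler_wpM2l ?sqr_ge0//.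
by apply: mxtrace_mul_le => //; [exact: psdC.1|exact: psdX.1].
Qed.

(** * Tail bounds from Laplace transforms *)

Section Tails.
Context {R : realType} {d : measure_display} {T : measurableType d}.
Variable P : probability T R.

Lemma measurable_gt_set (X : T -> R) (y : R) : measurable_fun setT X ->
  measurable [set w | (y < X w)%R].
Proof.
move=> mX; rewrite (_ : [set w | _] = setT `&` X @^-1` `]y, +oo[%classic).
  by apply: mX.
by rewrite setTI; apply/seteqP; split=> w /=; rewrite in_itv/= andbT.
Qed.

Lemma chernoff_bound (X : T -> R) (t y B : R) : measurable_fun setT X -> 0 < t ->
  (\int[P]_w (expR (t * X w))%:E <= (expR B)%:E)%E ->
  (P [set w | (y <= X w)%R] <= (expR (B - t * y))%:E)%E.
Proof.
move=> mX t0 mgf.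
pose Z : {RV P >-> R} := mfun_Sub (mem_set mX : X \in mfun).
apply: le_trans (chernoff Z y t0) _.
rewrite expRD EFinM lee_wpmul2r ?lee_fin ?expR_ge0//.
apply: le_trans mgf; rewrite /mmt_gen_fun unlock le_eqVlt; apply/predU1P; left.
apply: eq_integral => w _ /=.
by rewrite mulrC.
Qed.

(** Letting [t] grow in the Chernoff bound kills every level [k.+1%:R^-1]; countably many levels
    exhaust the event. *)
Lemma prob_gt0_eq0 (X : T -> R) : measurable_fun setT X ->
  (forall t, 0 < t -> (\int[P]_w (expR (t * X w))%:E <= 1)%E) ->
  P [set w | (0 < X w)%R] = 0%E.
Proof.
move=> mX mgf.
pose A k := [set w | (k.+1%:R^-1 <= X w)%R].
have mA k : measurable (A k).
  by rewrite -[X in measurable X]setTI; exact: measurable_fun_le.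
have A0 k : P (A k) = 0%E.
  apply/eqP; rewrite eq_le measure_ge0 andbT; apply/lee_addgt0Pr => e e0.
  (* The exponent becomes [- e^-1], and [expR (- e^-1) <= e]. *)
  rewrite add0e; pose t := e^-1 * k.+1%:R.
  have t0 : 0 < t by rewrite mulr_gt0 ?invr_gt0.
  have mgf0 : (\int[P]_w (expR (t * X w))%:E <= (expR 0)%:E)%E.
    by rewrite expR0; exact: mgf.
  apply: le_trans (chernoff_bound k.+1%:R^-1 mX t0 mgf0) _.
  rewrite sub0r /t mulfK// expRN lee_fin invf_ple ?posrE ?expR_gt0//.
  by apply: le_trans (expR_ge1Dx _); rewrite lerDr.
apply/eqP; rewrite eq_le measure_ge0 andbT.
apply: le_trans (measure_sigma_subadditive P mA _ _) _ => //.
- exact: measurable_gt_set.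
- move=> w /= Xw; exists (Num.bound (X w)^-1) => //=.
  have Xw' : 0 <= (X w)^-1 by rewrite invr_ge0 ltW.
  rewrite /A /= invf_ple ?posrE// ltW// (lt_trans (archi_boundP Xw'))//.
  by rewrite ltr_nat.
- rewrite eseries0 => [|k _ _]; [exact: lexx|exact: A0].
Qed.

(** Chernoff at [t = r / (a + 2 * r * b)] with [r = Num.sqrt L]. Then [t * b <= 1 / 2], so [t] is
    admissible, and [t * a <= r]. Since [t * a + 2 * r * t * b = r], the exponent is at most
    [2 * r ^+ 2 - 4 * r ^+ 2 = - 2 * L]. *)
Lemma subexponential_tail (X : T -> R) (a b L : R) : measurable_fun setT X ->
  0 <= a -> 0 <= b -> 0 <= L ->
  (forall t, 0 < t -> 3 * t ^+ 2 * b ^+ 2 <= 1 ->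
     (\int[P]_w (expR (t * X w))%:E <= (expR (2 * t ^+ 2 * a ^+ 2))%:E)%E) ->
  (P [set w | (8 * (Num.sqrt L * a + L * b) < X w)%R] <= (expR (- 2 * L))%:E)%E.
Proof.
move=> mX a0 b0; rewrite le_eqVlt => /predU1P[<- _|L0 mgf].
  rewrite mulr0 expR0; apply: probability_le1.
  exact: measurable_gt_set.
set r := Num.sqrt L; have r0 : 0 < r by rewrite sqrtr_gt0.
have -> : L = r * r by rewrite -expr2 sqr_sqrtr// ltW.
(* A zero denominator forces [a = b = 0]; the threshold is then [0] and all positive [t] are
   admissible. *)
have [D0|D_gt0] := leP (a + 2 * r * b) 0.
  have rb0 : 0 <= 2 * r * b by rewrite !mulr_ge0// ltW.
  have a_eq0 : a = 0 by lra.
  have b_eq0 : b = 0.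
    have /eqP : 2 * r * b = 0 by lra.
    by rewrite mulf_eq0 gt_eqF ?mulr_gt0// => /eqP.
  rewrite a_eq0 b_eq0 !mulr0 addr0 mulr0 prob_gt0_eq0 ?lee_fin ?expR_ge0// => t t0.
  have := mgf t t0; rewrite a_eq0 b_eq0 expr0n !mulr0 expR0; exact.
pose t := r / (a + 2 * r * b).
have t0 : 0 < t by rewrite divr_gt0.
have tD : t * (a + 2 * r * b) = r by rewrite /t divfK// gt_eqF.
have tb : t * b <= 1 / 2.
  have : t * b * (2 * r) <= 1 * r by rewrite mul1r -[leRHS]tD; nra.
  by rewrite mulrA ler_pM2r//; lra.
have tb0 : 0 <= t * b by rewrite mulr_ge0// ltW.
have rE : t * a + 2 * (r * (t * b)) = r by rewrite -[RHS]tD; ring.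
have rtb0 : 0 <= r * (t * b) by rewrite mulr_ge0// ltW.
have ta : t * a <= r by lra.
have ta0 : 0 <= t * a by rewrite mulr_ge0// ltW.
have small : 3 * t ^+ 2 * b ^+ 2 <= 1 by rewrite -mulrA -exprMn; nra.
apply: (@le_trans _ _ (P [set w | (8 * (r * a + r * r * b) <= X w)%R])).
  apply: le_measure; rewrite ?inE.
  - exact: measurable_gt_set.
  - by rewrite -[X in measurable X]setTI; exact: measurable_fun_le.
  - by move=> w /= /ltW.
apply: le_trans (chernoff_bound _ mX t0 (mgf _ t0 small)) _.
rewrite lee_fin ler_expR.
have -> : t * (8 * (r * a + r * r * b)) = 8 * r * (t * a) + 8 * r * (r * (t * b)) by ring.
have -> : 2 * t ^+ 2 * a ^+ 2 = 2 * (t * a) ^+ 2 by ring.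
nra.
Qed.

End Tails.

(** * Companion matrices and the noise decomposition *)

(** Since [Q] maps the grid onto itself, the [pick] succeeds and the default of [odflt] never
    intervenes. *)
Lemma comp_idxP (R : realType) k p (x : 'I_p -> 'cV[R]_k) (Q : 'M[R]_k) a :
  is_rotation Q -> preserves_grid x Q -> x (comp_idx x Q a) = invmx Q *m x a.
Proof.
move=> [QQ _] [_ surj]; have [_ Qu] := mulmx1_unit QQ.
have {}Qu : Q \in unitmx by rewrite -unitmx_tr.
rewrite /comp_idx; case: pickP => [b /eqP //|no].
have [b xb] := surj a; have := no b.
by rewrite -xb mulKmx// eqxx.
Qed.

(** The index map is injective on a finite type, so the sum can be reindexed along it. *)
Lemma dot_compmx (R : realType) k p (x : 'I_p -> 'cV[R]_k) (Q : 'M[R]_k) u v :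
  injective x -> is_rotation Q -> preserves_grid x Q ->
  dot (compmx x Q *m u) (compmx x Q *m v) = dot u v.
Proof.
move=> x_inj rotQ gridQ.
have compE w a : (compmx x Q *m w) a 0 = w (comp_idx x Q a) 0.
  rewrite mxE (bigD1 (comp_idx x Q a))//= big1 => [|b /negbTE ba].
    by rewrite mxE eqxx mul1r addr0.
  by rewrite mxE ba mul0r.
have idx_inj : injective (comp_idx x Q).
  move=> a b ab; have [_ Qu] := mulmx1_unit rotQ.1.
  have {}Qu : Q \in unitmx by rewrite -unitmx_tr.
  apply: x_inj; apply: (can_inj (mulKVmx Qu)).
  by rewrite -!comp_idxP// ab.
by rewrite !dotE [RHS](reindex_inj idx_inj); apply: eq_bigr => a _; rewrite !compE.
Qed.

(** Specialises the bounds of G1 to the untransformed [Sigma i] and [S i]. *)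
Lemma compmx1 (R : realType) k p (x : 'I_p -> 'cV[R]_k) :
  injective x -> compmx x 1%:M = 1%:M.
Proof.
move=> x_inj; apply/matrixP => a b; rewrite !mxE eq_sym. congr (_ == _)%:R.
rewrite /comp_idx invmx1 mul1mx; case: pickP => [c /eqP xc|/(_ a)] /=.
  exact: x_inj.
by rewrite eqxx.
Qed.

(* [|Si + Ni - M (Sj + Nj)|^2 = |Si - M Sj|^2 - 2 noise + const] when [M] is
   orthogonal, with [const] independent of [M]. *)
Definition noise (R : realType) q (Si Sj Ni Nj : 'cV[R]_q) (M : 'M[R]_q) : R :=
  dot Si (M *m Nj) + dot (M *m Sj) Ni + dot Ni (M *m Nj).

(** To be used with [M] from the noisy and [M'] from the clean minimiser; the constants of the two
    expansions cancel. *)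
Lemma clean_le_noise (R : realType) q (Si Sj Ni Nj : 'cV[R]_q) (M M' : 'M[R]_q) :
  (forall u v, dot (M *m u) (M *m v) = dot u v) ->
  (forall u v, dot (M' *m u) (M' *m v) = dot u v) ->
  enorm ((Si + Ni) - M *m (Sj + Nj)) <= enorm ((Si + Ni) - M' *m (Sj + Nj)) ->
  enorm (Si - M *m Sj) ^+ 2 <= enorm (Si - M' *m Sj) ^+ 2
    + 2 * (noise Si Sj Ni Nj M - noise Si Sj Ni Nj M').
Proof.
move=> isoM isoM'.
rewrite -(@ler_pXn2r _ 2) ?nnegrE ?enorm_ge0// !enorm_sqr /noise.
have expand A : (forall u v, dot (A *m u) (A *m v) = dot u v) ->
    dot (Si + Ni - A *m (Sj + Nj)) (Si + Ni - A *m (Sj + Nj)) =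
    dot (Si - A *m Sj) (Si - A *m Sj)
    - 2 * (dot Si (A *m Nj) + dot (A *m Sj) Ni + dot Ni (A *m Nj))
    + (2 * dot Si Ni + dot Ni Ni + 2 * dot Sj Nj + dot Nj Nj).
  move=> isoA; rewrite mulmxDr !(dotDl, dotDr, dotNl, dotNr, opprD) !isoA.
  rewrite (dotC Ni Si) (dotC Nj Sj) (dotC (A *m Sj) Si) (dotC (A *m Nj) Si).
  by rewrite (dotC (A *m Nj) Ni) (dotC (A *m Sj) Ni); ring.
rewrite (expand _ isoM) (expand _ isoM').
lra.
Qed.

(** * Uniform control of the noise by a union bound *)

(** Joint independence is applied with [setT] at every index other than [i] and [j]. *)
Lemma indep_vecs_pair (R : realType) d (T : measurableType d) n q
    (P : probability T R) (X : 'I_n -> T -> 'cV[R]_q) (i j : 'I_n) A B :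
  indep_vecs P X -> i != j -> sigma_vec (X i) A -> sigma_vec (X j) B ->
  P (A `&` B) = (P A * P B)%E.
Proof.
move=> indep ij sA sB.
pose C l := if l == i then A else if l == j then B else setT.
have sC l : sigma_vec (X l) (C l).
  rewrite /C; have [->//|_] := eqVneq l i; have [->//|_] := eqVneq l j.
  by rewrite -setC0; apply: sigma_algebraC; exact: sigma_algebra0.
have -> : A `&` B = \bigcap_(l in [set: 'I_n]) C l.
  apply/seteqP; split=> [w [Aw Bw] l _|w Cw].
    by rewrite /C; case: ifP => // _; case: ifP.
  split; first by have := Cw i I; rewrite /C eqxx.
  by have := Cw j I; rewrite /C eqxx eq_sym (negbTE ij).
rewrite (indep C sC) (bigD1 i)//= (bigD1 j) 1?eq_sym//= big1 => [|l /andP[li lj]].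
  by rewrite mule1 /C eqxx (eq_sym j) (negbTE ij) eqxx.
by rewrite /C (negbTE li) (negbTE lj) probability_setT.
Qed.

Lemma subexponential_tail2 (R : realType) d (T : measurableType d)
    (P : probability T R) (X : T -> R) (a b L : R) : measurable_fun setT X ->
  0 <= a -> 0 <= b -> 0 <= L ->
  (forall t, 3 * t ^+ 2 * b ^+ 2 <= 1 ->
     (\int[P]_w (expR (t * X w))%:E <= (expR (2 * t ^+ 2 * a ^+ 2))%:E)%E) ->
  let B := [set w | (8 * (Num.sqrt L * a + L * b) < `|X w|)%R] in
  measurable B /\ (P B <= (2 * expR (- 2 * L))%:E)%E.
Proof.
move=> mX a0 b0 L0 mgf; set y := 8 * _ => B.
have mNX : measurable_fun setT (fun w => - X w) by exact: measurable_funN.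
have BE : B = [set w | (y < X w)%R] `|` [set w | (y < - X w)%R].
  by apply/seteqP; rewrite /B; split=> w /=; rewrite ltr_normr; [move=> /orP|move=> ?; apply/orP].
rewrite BE; split; first by apply: measurableU; exact: measurable_gt_set.
apply: le_trans (measureU2 _ _ _) _; [exact: measurable_gt_set..|].
rewrite mulr_natl mulr2n EFinD leeD//; apply: subexponential_tail => // t _ tb.
  exact: mgf.
under eq_integral do rewrite mulrN -mulNr.
by apply: le_trans (mgf (- t) _) _; rewrite sqrrN.
Qed.

Lemma gaussian_linear_tail (R : realType) d (T : measurableType d) q
    (P : probability T R) (X : T -> 'cV[R]_q) (S : 'M[R]_q) c (a L : R) :
  gaussian_vec P X S -> 0 <= a -> 0 <= L -> dot c (S *m c) <= a ^+ 2 ->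
  let B := [set w | (8 * (Num.sqrt L * a) < `|dot c (X w)|)%R] in
  measurable B /\ (P B <= (2 * expR (- 2 * L))%:E)%E.
Proof.
move=> gX a0 L0 ca; have [_ [_ [mX _]]] := gX.
have := @subexponential_tail2 R d T P (fun w => dot c (X w)) a 0 L.
rewrite mulr0 addr0; apply=> // [|t _]; first exact: measurable_dot.
under eq_integral do rewrite -dotZl.
rewrite (gaussian_vec_mgf _ gX) lee_fin ler_expR -scalemxAr dotZl dotZr.
have -> : 2 * t ^+ 2 * a ^+ 2 = t * (t * a ^+ 2) / 2 * 4 by field.
have : t * (t * dot c (S *m c)) <= t * (t * a ^+ 2).
  rewrite -subr_ge0 (_ : _ - _ = t ^+ 2 * (a ^+ 2 - dot c (S *m c))); last by ring.
  by rewrite mulr_ge0 ?sqr_ge0// subr_ge0.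
have : 0 <= t * (t * a ^+ 2) by rewrite mulrA -expr2 mulr_ge0 ?sqr_ge0.
lra.
Qed.

Lemma prob_avoid_seq (R : realType) d (T : measurableType d) (P : probability T R)
    (I : eqType) (r : seq I) (B : I -> set T) (c : R) :
  (forall i, i \in r -> measurable (B i) /\ (P (B i) <= c%:E)%E) ->
  exists A : set T, [/\ measurable A, ((1 - (size r)%:R * c)%:E <= P A)%E &
    forall w i, A w -> i \in r -> ~ B i w].
Proof.
move=> Bc.
suff [U [mU PU UB]] : exists U : set T, [/\ measurable U,
    (P U <= ((size r)%:R * c)%:E)%E & forall w i, i \in r -> B i w -> U w].
  exists (~` U); split; [exact: measurableC| |].
    rewrite probability_setC// EFinB leeB//.
  by move=> w i Uw ir /(UB _ _ ir).
elim: r Bc => [_|i r IH Bc].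
  by exists set0; split; rewrite ?measure0 ?mul0r.
have [|U [mU PU UB]] := IH; first by move=> k kr; apply: Bc; rewrite inE kr orbT.
have [mBi PBi] := Bc i (mem_head _ _).
exists (B i `|` U); split; first exact: measurableU.
  apply: le_trans (measureU2 _ mBi mU) _.
  by rewrite /= -natr1 mulrDl mul1r addrC EFinD leeD.
move=> w k; rewrite inE => /predU1P[->|kr] Bw; first by left.
by right; exact: UB Bw.
Qed.

Lemma measurable_dot_mulmx (R : realType) d (T : measurableType d) q
    (X Y : T -> 'cV[R]_q) (M : 'M[R]_q) :
  (forall a, measurable_fun setT (fun w => X w a 0)) ->
  (forall a, measurable_fun setT (fun w => Y w a 0)) ->
  measurable_fun setT (fun w => dot (X w) (M *m Y w)).
Proof.
move=> mX mY; under eq_fun do rewrite dotE; apply: measurable_sum => a.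
apply: measurable_funM => //; under eq_fun do rewrite mxE.
by apply: measurable_sum => b; apply: measurable_funM.
Qed.

(** Each of the three terms fails with probability at most [2 * expR (- 2 * L)], whence [6]. The two
    linear terms contribute [8] each to the coefficient of [K * l], whence [16]; the bilinear one
    needs only [8]. *)
Lemma noise_tail (R : realType) d (T : measurableType d) q (P : probability T R)
    (X Y : T -> 'cV[R]_q) (SX SY M : 'M[R]_q) (u v : 'cV[R]_q) (s2 l K L : R) :
  let C := M *m SY *m M^T in
  gaussian_vec P X SX -> gaussian_vec P Y SY ->
  (forall A B, sigma_vec X A -> sigma_vec Y B -> P (A `&` B) = (P A * P B)%E) ->
  0 <= s2 -> 0 <= l -> 0 <= K -> 0 <= L ->
  (forall w, dot w (SX *m w) <= l ^+ 2 * dot w w) ->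
  (forall w, dot w (C *m w) <= l ^+ 2 * dot w w) ->
  \tr (SX *m SX) <= s2 ^+ 2 -> \tr (C *m C) <= s2 ^+ 2 ->
  enorm u <= K -> enorm (M *m v) <= K ->
  exists B : set T, [/\ measurable B, (P B <= (6 * expR (- 2 * L))%:E)%E &
    forall w, ~ B w -> `|noise u v (X w) (Y w) M| <=
      16 * (Num.sqrt L * (s2 + K * l) + L * l ^+ 2)].
Proof.
move=> C gX gY indep s0 l0 K0 L0 SXl Cl SXs Cs uK vK.
have [_ [_ [mX _]]] := gX; have [_ [_ [mY _]]] := gY.
have Kl0 : 0 <= K * l by rewrite mulr_ge0.
have sqr_le z S : enorm z <= K -> dot z (S *m z) <= l ^+ 2 * dot z z ->
    dot z (S *m z) <= (K * l) ^+ 2.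
  move=> zK Sz; apply: le_trans Sz _; rewrite -enorm_sqr exprMn mulrC.
  by rewrite ler_wpM2r ?sqr_ge0// ler_pXn2r ?nnegrE// enorm_ge0.
have var1 : dot (M^T *m u) (SY *m (M^T *m u)) <= (K * l) ^+ 2.
  by rewrite -dot_mulmxr !mulmxA; apply: sqr_le.
have var2 : dot (M *m v) (SX *m (M *m v)) <= (K * l) ^+ 2 by exact: sqr_le.
have [mB1 PB1] := gaussian_linear_tail gY Kl0 L0 var1.
have [mB2 PB2] := gaussian_linear_tail gX Kl0 L0 var2.
have mgf3 t : 3 * t ^+ 2 * (l ^+ 2) ^+ 2 <= 1 ->
    (\int[P]_w (expR (t * dot (X w) (M *m Y w)))%:E <=
     (expR (2 * t ^+ 2 * s2 ^+ 2))%:E)%E.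
  move=> tl; have l20 : 0 <= l ^+ 2 by exact: sqr_ge0.
  apply: le_trans (gaussian_bilinear_mgf gX gY indep l20 SXl Cl SXs Cs tl) _.
  rewrite lee_fin ler_expR; have := mulr_ge0 (sqr_ge0 t) (sqr_ge0 s2); lra.
have [mB3 PB3] := subexponential_tail2 (measurable_dot_mulmx M mX mY) s0 (sqr_ge0 l) L0 mgf3.
move: mB1 PB1 mB2 PB2 mB3 PB3.
set B1 := [set w | _]; set B2 := [set w | _]; set B3 := [set w | _].
move=> mB1 PB1 mB2 PB2 mB3 PB3.
exists (B1 `|` B2 `|` B3); split.
- by apply: measurableU => //; exact: measurableU.
- apply: le_trans (measureU2 _ _ _) _ => //; first exact: measurableU.
  rewrite (_ : 6 * _ = 2 * expR (- 2 * L) + 2 * expR (- 2 * L) + 2 * expR (- 2 * L)); last by ring.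
  rewrite 2!EFinD leeD//.
  by apply: le_trans (measureU2 _ _ _) _ => //; exact: leeD.
move=> w /not_orP[/not_orP[/negP]]; rewrite -leNgt => w1 /negP; rewrite -leNgt => w2.
move=> /negP; rewrite -leNgt => w3.
rewrite /noise dot_mulmxr.
apply: le_trans (ler_normD _ _) _.
have := ler_normD (dot (M^T *m u) (Y w)) (dot (M *m v) (X w)).
have : 0 <= Num.sqrt L * s2 by rewrite mulr_ge0// sqrtr_ge0.
have : 0 <= L * l ^+ 2 by rewrite mulr_ge0// sqr_ge0.
move: w1 w2 w3; lra.
Qed.

Lemma uniform_noise_bound (R : realType) d (T : measurableType d)
    (P : probability T R) (k n p : nat) (x : 'I_p -> 'cV[R]_k) (Tk : seq 'M[R]_k)
    (S : 'I_n -> 'cV[R]_p) (Sigma : 'I_n -> 'M[R]_p) (N : 'I_n -> T -> 'cV[R]_p)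
    (sigma s K : R) :
  (0 < n)%N -> (0 < p)%N -> injective x -> 1%:M \in Tk ->
  (forall i, gaussian_vec P (N i) (Sigma i)) -> indep_vecs P N ->
  0 <= sigma -> 0 <= K ->
  (forall i Q, Q \in Tk ->
     let PQ := compmx x Q in
     let C := PQ *m Sigma i *m PQ^T in
     [/\ opnorm C <= sigma ^+ 2, Num.sqrt (\tr (C *m C) / p%:R) <= s ^+ 2
       & enorm (PQ *m S i) <= K]) ->
  let L := ln ((card_comp x Tk)%:R * n%:R ^+ 2) in
  exists A : set T, [/\ measurable A, ((1 - 6 / n%:R)%:E <= P A)%E &
    forall w, A w -> forall i j Q, i != j -> Q \in Tk ->
      `|noise (S i) (S j) (N i w) (N j w) (compmx x Q)| <=
      16 * (Num.sqrt L * (Num.sqrt p%:R * s ^+ 2 + K * sigma) + L * sigma ^+ 2)].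
Proof.
move=> n0 p0 x_inj T1 gN indepN sigma0 K0 G1 L.
set comps := undup [seq compmx x Q | Q <- Tk].
have card_gt0 : (0 < size comps)%N.
  suff : compmx x 1%:M \in comps by case: comps.
  by rewrite mem_undup map_f.
have arg_ge : n%:R <= (size comps)%:R * n%:R ^+ 2 :> R.
  rewrite -natrX -natrM ler_nat -{1}(mul1n n) leq_mul// -{1}(expn1 n).
  by rewrite leq_pexp2l.
have arg_ge1 : 1 <= (size comps)%:R * n%:R ^+ 2 :> R.
  by apply: le_trans arg_ge; rewrite ler1n.
have L0 : 0 <= L by rewrite ln_ge0.
have expL : expR L = (size comps)%:R * n%:R ^+ 2.
  by rewrite lnK// posrE (lt_le_trans ltr01).
have trace_le (C : 'M[R]_p) : C^T = C -> Num.sqrt (\tr (C *m C) / p%:R) <= s ^+ 2 ->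
    \tr (C *m C) <= (Num.sqrt p%:R * s ^+ 2) ^+ 2.
  move=> CE trC; have pR : 0 < p%:R :> R by rewrite ltr0n.
  rewrite exprMn sqr_sqrtr ?ler0n// mulrC -ler_pdivrMr//.
  rewrite -[leLHS]sqr_sqrtr ?divr_ge0 ?mxtrace_sqr_ge0 ?ler0n//.
  by rewrite ler_pXn2r ?nnegrE ?sqrtr_ge0// sqr_ge0.
have G1id i : [/\ forall w, dot w (Sigma i *m w) <= sigma ^+ 2 * dot w w,
    \tr (Sigma i *m Sigma i) <= (Num.sqrt p%:R * s ^+ 2) ^+ 2 & enorm (S i) <= K].
  have := G1 i _ T1; rewrite compmx1//= trmx1 !mul1mx !mulmx1 => -[op tr SK].
  split=> // [w|]; first exact: opnorm_quad.
  by apply: trace_le => //; exact: (gN i).1.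
(* The union runs over distinct companion matrices, the number counted in [L], rather than over the
   rotations in [Tk]. *)
pose idx := [seq (ij, M) | ij <- [seq ij <- enum {: 'I_n * 'I_n} | ij.1 != ij.2], M <- comps].
have bad z : z \in idx -> exists B : set T, [/\ measurable B,
    (P B <= (6 * expR (- 2 * L))%:E)%E & forall w, ~ B w ->
    `|noise (S z.1.1) (S z.1.2) (N z.1.1 w) (N z.1.2 w) z.2| <=
    16 * (Num.sqrt L * (Num.sqrt p%:R * s ^+ 2 + K * sigma) + L * sigma ^+ 2)].
  move=> /allpairsP[[[i j] M] /= [+ + ->]] /=.
  rewrite mem_filter /= mem_undup => /andP[ij _] /mapP[Q TQ ->].
  have [SXl SXs SK] := G1id i; have [op tr SjK] := G1 j Q TQ.
  apply: (noise_tail (gN i) (gN j)) => //.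
  - by move=> A B; exact: indep_vecs_pair.
  - by rewrite mulr_ge0 ?sqrtr_ge0 ?sqr_ge0.
  - by move=> w; exact: opnorm_quad.
  - by apply: trace_le => //; rewrite !trmx_mul trmxK (gN j).1 mulmxA.
have [B BP] : exists B, forall z, z \in idx -> [/\ measurable (B z),
    (P (B z) <= (6 * expR (- 2 * L))%:E)%E & forall w, ~ B z w ->
    `|noise (S z.1.1) (S z.1.2) (N z.1.1 w) (N z.1.2 w) z.2| <=
    16 * (Num.sqrt L * (Num.sqrt p%:R * s ^+ 2 + K * sigma) + L * sigma ^+ 2)].
  have /choice[B BP] : forall z, exists B : set T, z \in idx -> [/\ measurable B,
    (P B <= (6 * expR (- 2 * L))%:E)%E & forall w, ~ B w ->
    `|noise (S z.1.1) (S z.1.2) (N z.1.1 w) (N z.1.2 w) z.2| <=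
    16 * (Num.sqrt L * (Num.sqrt p%:R * s ^+ 2 + K * sigma) + L * sigma ^+ 2)].
    move=> z; have [zidx|_] := boolP (z \in idx); last by exists set0.
    by have [B BP] := bad z zidx; exists B.
  by exists B.
have [|A [mA PA AB]] := @prob_avoid_seq R d T P _ idx B (6 * expR (- 2 * L)).
  by move=> z /BP[].
exists A; split=> // [|w Aw i j Q ij TQ].
  apply: le_trans PA; rewrite lee_fin lerB//.
  have size_idx : (size idx <= n ^ 2 * size comps)%N.
    rewrite size_allpairs leq_mul2r size_filter (leq_trans (count_size _ _)) ?orbT//.
    by rewrite -cardE card_prod card_ord.
  apply: (@le_trans _ _ (expR L * (6 * expR (- 2 * L)))).
    rewrite ler_wpM2r ?mulr_ge0 ?expR_ge0// expL -natrX -natrM ler_nat mulnC.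
    exact: size_idx.
  (* At most [expR L] events, each of probability at most [6 * expR (- 2 * L)], leave
     [6 * expR (- L)], and [expR L >= n]. *)
  rewrite mulrCA -expRD (_ : L + - 2 * L = - L); last by ring.
  by rewrite expRN ler_wpM2l// lef_pV2 ?posrE ?expR_gt0 ?ltr0n// expL.
have zidx : ((i, j), compmx x Q) \in idx.
  apply/allpairsP; exists ((i, j), compmx x Q); split=> //=.
    by rewrite mem_filter ij mem_enum.
  by rewrite mem_undup map_f.
have [_ _ BN] := BP _ zidx.
by apply: BN; exact: AB Aw zidx.
Qed.

(** * Rates and conclusion *)

Lemma le_powR_small (R : realType) (c eta : R) : 0 < c -> 0 < eta < 1 ->
  exists2 r : R, 0 < r & forall u, 0 <= u -> u < r ->
    64 * u <= u `^ (1 - eta) /\ u `^ (1 - eta) < c.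
Proof.
move=> c0 /andP[eta0 eta1]; have eta1' : 0 < 1 - eta by rewrite subr_gt0.
have lt_root b e v : 0 < b -> 0 < e -> 0 <= v -> v < b `^ e^-1 -> v `^ e < b :> R.
  move=> b0 e0 v0 vb; have := gt0_ltr_powR e0 _ _ vb.
  rewrite -powRrM mulVf ?gt_eqF// powRr1 ?(ltW b0)//.
  by apply; rewrite nnegrE// powR_ge0.
exists (Num.min ((64^-1) `^ eta^-1) (c `^ (1 - eta)^-1)).
  by rewrite lt_min !powR_gt0// invr_gt0.
move=> u u0; rewrite lt_min => /andP[u1 u2]; split; last exact: lt_root.
have [->|u_neq0] := eqVneq u 0; first by rewrite mulr0 powR_ge0.
have {1}<- : u `^ (1 - eta) * u `^ eta = u.
  by rewrite -powRD ?subrK ?powRr1// u_neq0 implybT.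
have small : u `^ eta < 64^-1 by apply: lt_root => //; rewrite invr_gt0.
rewrite mulrCA ler_piMr ?powR_ge0//.
lra.
Qed.

(** Turns the limit in G1 into smallness of [u]: the three terms are bounded by [e], [|K| * e] and
    [e ^+ 2 <= e]. *)
Lemma rate_small (R : realType) (rL a b K e r : R) : 0 <= rL -> 0 <= a -> 0 <= b ->
  0 < e -> e <= 1 -> e * (2 + `|K|) <= r -> rL * Num.max a b < e ->
  rL * (a + K * b) + rL ^+ 2 * b ^+ 2 < r.
Proof.
move=> rL0 a0 b0 e0 e1 er Xe; apply: lt_le_trans er.
have La : rL * a < e by apply: le_lt_trans Xe; rewrite ler_wpM2l// le_max lexx.
have Lb : rL * b < e by apply: le_lt_trans Xe; rewrite ler_wpM2l// le_max lexx orbT.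
have Lb0 : 0 <= rL * b by exact: mulr_ge0.
have KLb : K * (rL * b) <= `|K| * e.
  apply: le_trans (ler_wpM2r Lb0 (ler_norm K)) _.
  by rewrite ler_wpM2l// ltW.
rewrite -exprMn; nra.
Qed.

Unset Implicit Arguments.

Theorem theorem2p2
  (R : realType) (k : nat)
  (d : measure_display) (Om : nat -> measurableType d)
  (P : forall m, probability (Om m) R)
  (n p : nat -> nat)
  (x : forall m, 'I_(p m) -> 'cV[R]_k)
  (Tk : forall m, seq 'M[R]_k)
  (S : forall m, 'I_(n m) -> 'cV[R]_(p m))
  (Sigma : forall m, 'I_(n m) -> 'M[R]_(p m))
  (N : forall m, 'I_(n m) -> Om m -> 'cV[R]_(p m))
  (dist : 'M[R]_k -> 'M[R]_k -> R)
  (Onoisy : forall m, Om m -> 'I_(n m) -> 'I_(n m) -> 'M[R]_k)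
  (Oclean : forall m, 'I_(n m) -> 'I_(n m) -> 'M[R]_k)
  (sigma s : nat -> R) (K : R) (g : R -> R)
  (* asymptotic regime n, p -> oo *)
  (n_oo : forall B : nat, exists m0 : nat, forall m, (m0 <= m)%N -> (B <= n m)%N)
  (p_oo : forall B : nat, exists m0 : nat, forall m, (m0 <= m)%N -> (B <= p m)%N)
  (* grid of distinct points; finite set of rotations containing the identity,
     each mapping the grid bijectively onto itself *)
  (grid_inj : forall m, injective (x m))
  (T_id : forall m, 1%:M \in Tk m)
  (T_rot : forall m Q, Q \in Tk m -> is_rotation Q /\ preserves_grid (x m) Q)
  (* independent Gaussian noise N_i ~ N(0, Sigma_i) *)
  (N_gauss : forall m i, gaussian_vec (P m) (N m i) (Sigma m i))
  (N_indep : forall m, indep_vecs (P m) (N m))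
  (* O*_{ij,noisy} is a minimiser of d_{ij,noisy} over T^(k)_exact *)
  (Onoisy_min : forall m w i j, Onoisy m w i j \in Tk m /\
     forall Q, Q \in Tk m ->
       enorm ((S m i + N m i w) - compmx (x m) (Onoisy m w i j) *m (S m j + N m j w))
       <= enorm ((S m i + N m i w) - compmx (x m) Q *m (S m j + N m j w)))
  (* O*_{ij,clean} is a minimiser of d^2_{ij,clean} over T^(k)_exact *)
  (Oclean_min : forall m i j, Oclean m i j \in Tk m /\
     forall Q, Q \in Tk m ->
       enorm (S m i - compmx (x m) (Oclean m i j) *m S m j) ^+ 2
       <= enorm (S m i - compmx (x m) Q *m S m j) ^+ 2)
  (* Assumption G1 for T = T_exact *)
  (sigma_ge0 : forall m, 0 <= sigma m)
  (G1_bounds : forall m i Q, Q \in Tk m ->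
     let PQ := compmx (x m) Q in
     let C := PQ *m Sigma m i *m PQ^T in
     [/\ opnorm C <= sigma m ^+ 2,
         Num.sqrt (\tr (C *m C) / (p m)%:R) <= s m ^+ 2
       & enorm (PQ *m S m i) <= K])
  (G1_lim : (fun m => Num.sqrt (ln ((card_comp (x m) (Tk m))%:R * (n m)%:R ^+ 2))
              * Num.max (Num.sqrt (p m)%:R * s m ^+ 2) (sigma m)) @ \oo --> (0 : R))
  (* Assumptions A0 and A1 *)
  (A0_A1 : exists2 delta : R, 0 < delta &
     exists gij : forall m, 'I_(n m) -> 'I_(n m) -> R -> R,
       (forall m i j (eps : R), eps < delta ->
          0 < gij m i j eps /\
          forall Q, Q \in Tk m ->
            enorm (S m i - compmx (x m) Q *m S m j) ^+ 2
              <= enorm (S m i - compmx (x m) (Oclean m i j) *m S m j) ^+ 2 + eps ->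
            dist Q (Oclean m i j) <= gij m i j eps)
       /\ (forall m i j (y : R), y <= delta -> gij m i j y <= g y))
  (g_to0 : g y @[y --> 0^'+] --> (0 : R)) :
  let u m := let L := ln ((card_comp (x m) (Tk m))%:R * (n m)%:R ^+ 2) in
             Num.sqrt L * (Num.sqrt (p m)%:R * s m ^+ 2 + K * sigma m)
             + L * sigma m ^+ 2 in
  forall eta : R, 0 < eta < 1 ->
  (* sup_{i <> j} d(O*_noisy, O*_clean) = O_P(g(u^(1-eta))) *)
  forall eps : R, 0 < eps ->
  exists M : R, exists m0 : nat, forall m, (m0 <= m)%N ->
    exists A : set (Om m), [/\ measurable A, ((1 - eps)%:E <= P m A)%E &
      forall w, A w -> forall i j : 'I_(n m), i != j ->
        dist (Onoisy m w i j) (Oclean m i j) <= M * g (u m `^ (1 - eta))].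
Proof.
move=> u eta eta01 eps eps0.
have [delta delta0 [gij [A0 A1]]] := A0_A1.
have [r r0 rP] := le_powR_small delta0 eta01.
pose e := Num.min 1 (r / (2 + `|K|)).
have K2 : 0 < 2 + `|K| by rewrite ltr_wpDr.
have e0 : 0 < e by rewrite lt_min ltr01 divr_gt0.
have eK : e * (2 + `|K|) <= r by rewrite -ler_pdivlMr// ge_min lexx orbT.
have [m1 _ m1P] := cvgr0_norm_lt _ G1_lim _ e0.
have [m2 m2P] := n_oo (Num.bound (6 / eps)).+1.
have [m3 m3P] := p_oo 1%N.
(* The thresholds make [u m < r], [6 / n <= eps] and [p > 0]; the constant [1] suffices because [64]
   is already absorbed. *)
exists 1, (maxn m1 (maxn m2 m3)) => m; rewrite !geq_max => /and3P[mm1 mm2 mm3].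
have n0 : (0 < n m)%N by apply: leq_trans (m2P m mm2).
have p0 : (0 < p m)%N by exact: m3P.
have K0 : 0 <= K.
  by have [_ _] := G1_bounds m (Ordinal n0) _ (T_id m); apply: le_trans; exact: enorm_ge0.
have [A [mA PA Anoise]] := uniform_noise_bound n0 p0 (@grid_inj m) (T_id m)
  (N_gauss m) (@N_indep m) (sigma_ge0 m) K0 (@G1_bounds m).
exists A; split=> //.
  apply: le_trans PA; rewrite lee_fin lerB// ler_pdivrMr ?ltr0n// mulrC -ler_pdivrMr//.
  have eps6 : 0 <= 6 / eps by rewrite divr_ge0// ltW.
  apply: le_trans (ltW (archi_boundP eps6)) _; rewrite ler_nat.
  by apply: ltnW; exact: m2P.
move=> w Aw i j ij; rewrite mul1r.
set L := ln _ in Anoise *.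
have card_gt0 : (0 < card_comp (x m) (Tk m))%N.
  rewrite /card_comp; case: undup (mem_undup [seq compmx (x m) Q | Q <- Tk m]) => //.
  move=> /(_ (compmx (x m) 1%:M)).
  by rewrite in_nil map_f.
have L0 : 0 <= L.
  by rewrite ln_ge0// -natrX -natrM ler1n muln_gt0 card_gt0 expn_gt0 n0.
have uE : u m = Num.sqrt L * (Num.sqrt (p m)%:R * s m ^+ 2 + K * sigma m)
    + Num.sqrt L ^+ 2 * sigma m ^+ 2.
  by rewrite /u sqr_sqrtr.
have ps0 : 0 <= Num.sqrt (p m)%:R * s m ^+ 2 by rewrite mulr_ge0 ?sqrtr_ge0 ?sqr_ge0.
have u0 : 0 <= u m.
  by rewrite uE addr_ge0 ?mulr_ge0 ?addr_ge0 ?sqr_ge0 ?sqrtr_ge0// mulr_ge0.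
have ur : u m < r.
  rewrite uE; apply: (rate_small (sqrtr_ge0 _) ps0 (sigma_ge0 m) e0 _ eK).
    by rewrite ge_min lexx.
  by apply: le_lt_trans (ler_norm _) _; exact: m1P.
have [u64 udelta] := rP _ u0 ur.
have [On_in On_min] := Onoisy_min m w i j; have [Oc_in _] := Oclean_min m i j.
have iso Q : Q \in Tk m -> forall v v', dot (compmx (x m) Q *m v) (compmx (x m) Q *m v') = dot v v'.
  by move=> /(T_rot m)[rotQ gridQ] v v'; exact: dot_compmx.
apply: le_trans (A1 m i j _ (ltW udelta)).
apply: (A0 m i j _ udelta).2 => //.
apply: le_trans (clean_le_noise (iso _ On_in) (iso _ Oc_in) (On_min _ Oc_in)) _.
rewrite lerD2l; apply: le_trans u64.
have := Anoise w Aw i j _ ij On_in; have := Anoise w Aw i j _ ij Oc_in.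
(* Two noise values, each within [16 * u m] of zero, differ by at most [32 * u m]; doubling gives
   [64 * u m]. *)
rewrite -[X in 16 * X]/(u m) !ler_norml => /andP[? ?] /andP[? ?].
lra.
Qed.
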